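(* Let $1<\alpha_1,\alpha_2<2$, $k_x,k_y>0$, $\eta>0$, $T>0$, and let $\hat f$ be Lipschitz continuous in its first argument (with Lipschitz constant $c_2>0$ uniform in $(x,y,t)$). Assume that the penalized problem (PP) in the context has a unique solution $u_\eta$, sufficiently smooth in the sense specified there. Then the finite difference scheme (S) given in the context is convergent: there is a positive constant $c$, independent of the temporal step $\Delta t$ and the spatial steps $h_x$, $h_y$, such that for all positive integers $n_1,n_2,m$ the errors $\delta_{i,j}^k=u_\eta(x_i,y_j,t_k)-u_{i,j}^k$ satisfy $$\|\delta^k\|_\infty=\max_{1\le i\le n_1,\,1\le j\le n_2}|\delta_{i,j}^k|\le c\,(\Delta t+h_x+h_y),\qquad 1\le k\le m.$$
   Context: $\Omega\subset\mathbb{R}^2$ is a convex region contained in the rectangle $\bar\Omega=(a,b)\times(c,d)$. The function $f(u,x,y,t)$ is defined for $(x,y)\in\Omega$, $t\in[0,T]$ and is Lipschitz in $u$ and in $t$. $\hat f$ is its extension by zero: $\hat f=f$ for $(x,y)\in\Omega$ and $\hat f=0$ for $(x,y)\in\bar\Omega\setminus\Omega$. Hence $|\hat f(u_1,x,y,t)-\hat f(u_2,x,y,t)|\le c_2|u_1-u_2|$. $\hat u_0$ is the extension to $\bar\Omega$ of the initial function $u_0$. $1_\Omega$ is the indicator function of $\Omega$. Penalized problem (PP): $$\frac{\partial u_{\eta}}{\partial t}-k_x\frac{\partial^{\alpha_1}u_{\eta}}{\partial|x|^{\alpha_1}}-k_y\frac{\partial^{\alpha_2}u_{\eta}}{\partial|y|^{\alpha_2}}+\frac{1-1_{\Omega}(x,y)}{\eta}u_{\eta}=\hat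 f(u_{\eta},x,y,t)\ \text{ in }\bar\Omega\times(0,T],$$ $u_\eta(x,y,0)=\hat u_0(x,y)$ on $\bar\Omega$, $u_\eta=0$ on $\partial\bar\Omega\times(0,T]$. Here $\frac{\partial^{\alpha_1}u}{\partial|x|^{\alpha_1}}=c_{\alpha_1}({}_{a}D_x^{\alpha_1}u+{}_xD_{b}^{\alpha_1}u)$ with $c_\alpha=-\frac{1}{2\cos(\alpha\pi/2)}>0$, where $${}_{a}D_{x}^{\alpha_1}u=\frac{1}{\Gamma(2-\alpha_1)}\frac{\partial^2}{\partial x^2}\int_{a}^{x}\frac{u(s,y,t)}{(x-s)^{\alpha_1-1}}ds,\qquad {}_xD_{b}^{\alpha_1}u=\frac{1}{\Gamma(2-\alpha_1)}\frac{\partial^2}{\partial x^2}\int_{x}^{b}\frac{u(s,y,t)}{(s-x)^{\alpha_1-1}}ds,$$ and $\frac{\partial^{\alpha_2}u}{\partial|y|^{\alpha_2}}$ is defined analogously in $y$ on $(c,d)$. Grid: for positive integers $n_1,n_2,m$, $h_x=\frac{b-a}{n_1+1}$, $h_y=\frac{d-c}{n_2+1}$, $\Delta t=\frac{T}{m}$, $x_i=a+ih_x$, $y_j=c+jh_y$, $t_k=k\Delta t$. Coefficients: $g_0^{(\alpha)}=1$, $g_l^{(\alpha)}=\left(1-\frac{\alpha+1}{l}\right)g_{l-1}^{(\alpha)}$ for $l\ge1$; $c_x=\frac{\Delta t\,k_xc_{\alpha_1}}{h_x^{\alpha_1}}$, $c_y=\frac{\Delta t\,k_yc_{\alpha_2}}{h_y^{\alpha_2}}$;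 $d_{i,j}=0$ if $(x_i,y_j)\in\Omega$ and $d_{i,j}=\frac{\Delta t}{\eta}$ if $(x_i,y_j)\in\bar\Omega\setminus\Omega$. Scheme (S): for $1\le i\le n_1$, $1\le j\le n_2$, $1\le k\le m$, $$u_{i,j}^{k}-c_x\Big(\sum_{l=0}^{i+1}g_{l}^{(\alpha_1)}u_{i-l+1,j}^k+\sum_{l=0}^{n_1-i+2}g_{l}^{(\alpha_1)}u_{i+l-1,j}^k\Big)-c_y\Big(\sum_{l=0}^{j+1}g_{l}^{(\alpha_2)}u_{i,j-l+1}^{k}+\sum_{l=0}^{n_2-j+2}g_{l}^{(\alpha_2)}u_{i,j+l-1}^k\Big)+d_{i,j}u_{i,j}^{k}=u_{i,j}^{k-1}+\Delta t\,\hat f(u_{i,j}^{k-1},x_i,y_j,t_{k-1}),$$ with $u_{i,j}^0=\hat u_0(x_i,y_j)$ for $0\le i\le n_1+1$, $0\le j\le n_2+1$, and $u_{0,j}^{k}=u_{n_1+1,j}^{k}=u_{i,0}^{k}=u_{i,n_2+1}^{k}=0$. Sufficient smoothness of $u_\eta$ (standing assumption): $u_\eta$ is smooth enough that the scheme is first-order consistent. That is, there is a constant $c_0$ independent of $h_x,h_y,\Delta t$ such that, when $u_{i,j}^k$ is replaced by $u_\eta(x_i,y_j,t_k)$ in (S), the equation holds with an additional term $\Delta t\,r_{i,j}^k$ on the right-hand side, where $|r_{i,j}^k|<c_0(h_x+h_y+\Delta t)$ for all $1\le i\le n_1$, $1\le j\le n_2$, $1\le k\le m$. *)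

(* Defs.v *)
From HB Require Import structures.
From mathcomp Require Import all_boot all_order all_algebra.
From mathcomp Require Import all_classical all_reals all_analysis.
Set Implicit Arguments.
Unset Strict Implicit.
Unset Printing Implicit Defensive.
Import Order.TTheory GRing.Theory Num.Theory.
Import numFieldNormedType.Exports.
Local Open Scope classical_set_scope.
Local Open Scope ring_scope.

(** * Riemann-Liouville and Riesz derivatives on a bounded interval *)

Definition Gamma {R : realType} (z : R) : R :=
  \int[lebesgue_measure]_(s in `]0, +oo[) (s `^ (z - 1) * expR (- s)).

Definition RL_left_int {R : realType} (alpha a : R) (v : R -> R) (x : R) : R :=
  \int[lebesgue_measure]_(s in `]a, x[) (v s / (x - s) `^ (alpha - 1)).

Definition RL_right_int {R : realType} (alpha b : R) (v : R -> R) (x : R) : R :=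
  \int[lebesgue_measure]_(s in `]x, b[) (v s / (s - x) `^ (alpha - 1)).

(* [derive1n] is a total operator, so existence has to be required separately. *)
Definition twice_derivable {R : realType} (J : R -> R) (x : R) : Prop :=
  (\forall z \near x, derivable J z 1) /\ derivable (derive1 J) x 1.

Definition RL_left {R : realType} (alpha a : R) (v : R -> R) (x : R) : R :=
  (Gamma (2 - alpha))^-1 * derive1n 2 (RL_left_int alpha a v) x.

Definition RL_right {R : realType} (alpha b : R) (v : R -> R) (x : R) : R :=
  (Gamma (2 - alpha))^-1 * derive1n 2 (RL_right_int alpha b v) x.

Definition riesz_coef {R : realType} (alpha : R) : R :=
  - (2 * cos (alpha * pi / 2))^-1.

Definition riesz {R : realType} (alpha a b : R) (v : R -> R) (x : R) : R :=
  riesz_coef alpha * (RL_left alpha a v x + RL_right alpha b v x).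

Definition riesz_derivable {R : realType} (alpha a b : R) (v : R -> R) (x : R)
    : Prop :=
  twice_derivable (RL_left_int alpha a v) x /\
  twice_derivable (RL_right_int alpha b v) x.

(* Derivative relative to [I]: two-sided at interior points of an interval,
   one-sided at its endpoints. *)
Definition is_derive_within {R : realType} (I : set R) (v : R -> R) (t l : R)
    : Prop :=
  (fun s => (v s - v t) / (s - t)) @ within I t^' --> l.

(** * The penalized problem *)

(* The rectangle is ]xmin, xmax[ x ]ymin, ymax[ and the time interval is
   [0, tmax]. The extension [u0hat] of [u0] is part of the data. *)
Record problem (R : realType) := Problem {
  xmin : R; xmax : R; ymin : R; ymax : R; tmax : R;
  alpha1 : R; alpha2 : R; kx : R; ky : R; eta_pen : R;
  Omega : set (R^o * R^o)%type;
  f : R -> R -> R -> R -> R;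
  u0 : R -> R -> R;
  u0hat : R -> R -> R }.

Definition rect {R : realType} (P : problem R) : set (R^o * R^o)%type :=
  `]xmin P, xmax P[ `*` `]ymin P, ymax P[.

Definition boundary {T : topologicalType} (A : set T) : set T :=
  closure A `\` A°.

Definition fhat {R : realType} (P : problem R) (v x y t : R) : R :=
  if (x, y) \in Omega P then f P v x y t else 0.

Definition pp_equation {R : realType} (P : problem R) (u : R -> R -> R -> R)
    (x y t : R) : Prop :=
  [/\ riesz_derivable (alpha1 P) (xmin P) (xmax P) (fun s => u s y t) x,
      riesz_derivable (alpha2 P) (ymin P) (ymax P) (fun s => u x s t) y
    & exists2 ut, is_derive_within `[0, tmax P] (u x y) t ut &
        ut - kx P * riesz (alpha1 P) (xmin P) (xmax P) (fun s => u s y t) x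
           - ky P * riesz (alpha2 P) (ymin P) (ymax P) (fun s => u x s t) y
           + (1 - \1_(Omega P) (x, y)) / eta_pen P * u x y t
        = fhat P (u x y t) x y t].

(* Continuity up to the parabolic boundary is what ties the initial and
   boundary values to the equation; without it uniqueness could never hold. *)
Definition pp_solution {R : realType} (P : problem R) (u : R -> R -> R -> R)
    : Prop :=
  [/\ {within closure (rect P) `*` `[0, tmax P],
        continuous (fun p => u p.1.1 p.1.2 p.2)},
      (forall x y t : R, rect P (x, y) -> 0 < t <= tmax P -> pp_equation P u x y t),
      (forall x y : R, rect P (x, y) -> u x y 0 = u0hat P x y)
    & (forall x y t : R, boundary (rect P) (x, y) -> 0 < t <= tmax P ->
        u x y t = 0)].

(* Functions are total on R^3: solutions are identified when they agree on the
   closed space-time cylinder. *)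
Definition unique_pp_solution {R : realType} (P : problem R)
    (u : R -> R -> R -> R) : Prop :=
  pp_solution P u /\
  forall v, pp_solution P v ->
    forall x y t : R, closure (rect P) (x, y) -> 0 <= t <= tmax P ->
      v x y t = u x y t.

(** * The finite difference scheme *)

Definition hx {R : realType} (P : problem R) (n1 : nat) : R :=
  (xmax P - xmin P) / n1.+1%:R.
Definition hy {R : realType} (P : problem R) (n2 : nat) : R :=
  (ymax P - ymin P) / n2.+1%:R.
Definition dt {R : realType} (P : problem R) (m : nat) : R := tmax P / m%:R.

Definition xg {R : realType} (P : problem R) (n1 i : nat) : R :=
  xmin P + i%:R * hx P n1.
Definition yg {R : realType} (P : problem R) (n2 j : nat) : R :=
  ymin P + j%:R * hy P n2.
Definition tg {R : realType} (P : problem R) (m k : nat) : R := k%:R * dt P m.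

Fixpoint g {R : realType} (alpha : R) (l : nat) : R :=
  if l is l'.+1 then (1 - (alpha + 1) / l%:R) * g alpha l' else 1.

Definition cx {R : realType} (P : problem R) (n1 m : nat) : R :=
  dt P m * kx P * riesz_coef (alpha1 P) / hx P n1 `^ alpha1 P.
Definition cy {R : realType} (P : problem R) (n2 m : nat) : R :=
  dt P m * ky P * riesz_coef (alpha2 P) / hy P n2 `^ alpha2 P.

Definition pen {R : realType} (P : problem R) (n1 n2 m i j : nat) : R :=
  if (xg P n1 i, yg P n2 j) \in Omega P then 0 else dt P m / eta_pen P.

(* Grid functions are written [w i j k]. For 1 <= i <= n1 and 1 <= j <= n2 none
   of the natural-number subtractions below is truncated. *)
Definition scheme_lhs {R : realType} (P : problem R) (n1 n2 m : nat)
    (w : nat -> nat -> nat -> R) (i j k : nat) : R :=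
  w i j k
  - cx P n1 m *
      (\sum_(0 <= l < i.+2) g (alpha1 P) l * w (i + 1 - l)%N j k
       + \sum_(0 <= l < (n1 - i + 3)%N) g (alpha1 P) l * w (i + l - 1)%N j k)
  - cy P n2 m *
      (\sum_(0 <= l < j.+2) g (alpha2 P) l * w i (j + 1 - l)%N k
       + \sum_(0 <= l < (n2 - j + 3)%N) g (alpha2 P) l * w i (j + l - 1)%N k)
  + pen P n1 n2 m i j * w i j k.

Definition scheme_rhs {R : realType} (P : problem R) (n1 n2 m : nat)
    (w : nat -> nat -> nat -> R) (i j k : nat) : R :=
  w i j k.-1
  + dt P m * fhat P (w i j k.-1) (xg P n1 i) (yg P n2 j) (tg P m k.-1).

Definition scheme_solution {R : realType} (P : problem R) (n1 n2 m : nat)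
    (w : nat -> nat -> nat -> R) : Prop :=
  [/\ (forall i j k, (1 <= i <= n1)%N -> (1 <= j <= n2)%N -> (1 <= k <= m)%N ->
         scheme_lhs P n1 n2 m w i j k = scheme_rhs P n1 n2 m w i j k),
      (forall i j, (i <= n1.+1)%N -> (j <= n2.+1)%N ->
         w i j 0%N = u0hat P (xg P n1 i) (yg P n2 j)),
      (forall j k, (j <= n2.+1)%N -> (1 <= k <= m)%N ->
         w 0%N j k = 0 /\ w n1.+1 j k = 0)
    & (forall i k, (i <= n1.+1)%N -> (1 <= k <= m)%N ->
         w i 0%N k = 0 /\ w i n2.+1 k = 0)].

Definition on_grid {R : realType} (P : problem R) (n1 n2 m : nat)
    (u : R -> R -> R -> R) (i j k : nat) : R :=
  u (xg P n1 i) (yg P n2 j) (tg P m k).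

Definition consistent {R : realType} (P : problem R) (u : R -> R -> R -> R)
    : Prop :=
  exists c0 : R, forall n1 n2 m : nat, (0 < n1)%N -> (0 < n2)%N -> (0 < m)%N ->
  exists r : nat -> nat -> nat -> R,
  forall i j k, (1 <= i <= n1)%N -> (1 <= j <= n2)%N -> (1 <= k <= m)%N ->
    scheme_lhs P n1 n2 m (on_grid P n1 n2 m u) i j k
      = scheme_rhs P n1 n2 m (on_grid P n1 n2 m u) i j k + dt P m * r i j k
    /\ `|r i j k| < c0 * (hx P n1 + hy P n2 + dt P m).

Definition max_norm {R : realType} (n1 n2 : nat) (delta : nat -> nat -> R) : R :=
  \big[Num.max/0]_(1 <= i < n1.+1) \big[Num.max/0]_(1 <= j < n2.+1)
    `|delta i j|.

(* Main.v *)
(** Among the weights [g alpha l] only [g alpha 1] is negative, and their partial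
    sums are nonpositive from [l = 1] on. At a point where a grid function
    vanishing on the boundary attains a nonnegative maximum, both discrete
    fractional sums are therefore nonpositive, so the implicit operator dominates
    the grid function there: it satisfies a maximum principle. The error thus
    obeys |delta^k| <= (1 + c2 dt) |delta^(k-1)| + dt C with C proportional to
    dt + hx + hy, and the discrete Gronwall inequality concludes. *)
Require Import Defs.
From HB Require Import structures.
From mathcomp Require Import all_boot all_order all_algebra.
From mathcomp Require Import all_classical all_reals all_analysis.
From mathcomp Require Import ring lra zify.
Import Order.TTheory GRing.Theory Num.Theory.
Import numFieldNormedType.Exports.
Local Open Scope classical_set_scope.
Local Open Scope ring_scope.

(** * Signs and partial sums of the Grunwald weights *)

(** The weight of index 2 is [alpha * (alpha - 1) / 2]; from index 3 on the recursion multiplies by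
    [1 - (alpha + 1) / l], which is positive because [alpha + 1 < 3]. *)
Lemma g_ge0 (R : realType) (alpha : R) l :
  1 < alpha < 2 -> l != 1%N -> 0 <= g alpha l.
Proof.
case/andP=> a1 a2; case: l => [|[//|l]] _; first exact: ler01.
elim: l => [|l IH]; first by rewrite /= ; nra.
rewrite [g _ _]/(_ * g alpha l.+2) mulr_ge0// subr_ge0 ler_pdivrMr ?ltr0n//.
by rewrite mul1r -[l.+3]addn3 natrD; have := ler0n R l; lra.
Qed.

(** As [g alpha l] is $(-1)^l\binom{\alpha}{l}$, the partial sum is $(-1)^n\binom{\alpha-1}{n}$.
    Writing it through [g alpha n.+1] reduces its sign to [g_ge0]. *)
Lemma sum_g (R : realType) (alpha : R) n : alpha != 0 ->
  \sum_(0 <= l < n.+1) g alpha l = - (n.+1%:R / alpha * g alpha n.+1).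
Proof.
move=> a0; elim: n => [|n IH]; first by rewrite big_nat1 /=; field.
rewrite big_nat_recr//= IH /=.
have n0 := ler0n R n.
by field; rewrite a0 ?andbT/=; apply/andP; split; lra.
Qed.

Lemma sum_g_le0 (R : realType) (alpha : R) n :
  1 < alpha < 2 -> (0 < n)%N -> \sum_(0 <= l < n.+1) g alpha l <= 0.
Proof.
move=> a12; have /andP[a1 a2] := a12; case: n => // n _.
rewrite sum_g; last by lra.
rewrite oppr_le0 mulr_ge0//; last exact: g_ge0.
by rewrite divr_ge0//; lra.
Qed.

(** Replacing every [v l] by [v 1] can only increase the sum: the sole negative weight sits at index
    1, where nothing changes. What remains is [v 1] times a nonpositive partial sum. *)
Lemma sum_gM_le0 {R : realType} {alpha : R} {n} {v : nat -> R} :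
  1 < alpha < 2 -> (0 < n)%N -> 0 <= v 1%N ->
  (forall l, (l <= n)%N -> v l <= v 1%N) ->
  \sum_(0 <= l < n.+1) g alpha l * v l <= 0.
Proof.
move=> a12 n0 v0 vle.
apply: (@le_trans _ _ (\sum_(0 <= l < n.+1) g alpha l * v 1%N)); last first.
  by rewrite -mulr_suml mulr_le0_ge0// sum_g_le0.
apply: ler_sum_nat => l /andP[_ ln].
have [->//|l1] := eqVneq l 1%N.
by rewrite ler_wpM2l ?vle// g_ge0.
Qed.

(** The stencil is shifted by one node, so the negative weight, at [l = 1], falls exactly on the
    maximal value [v i]. *)
Lemma left_stencil_le0 {R : realType} {alpha : R} {n i} {v : nat -> R} :
  1 < alpha < 2 -> (i <= n)%N -> 0 <= v i ->
  (forall i', (i' <= n.+1)%N -> v i' <= v i) ->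
  \sum_(0 <= l < i.+2) g alpha l * v (i + 1 - l)%N <= 0.
Proof.
move=> a12 iN v0 vmax.
apply: (sum_gM_le0 (v := fun l => v (i + 1 - l)%N)); rewrite ?addnK// => l _.
by rewrite vmax// (leq_trans (leq_subr _ _))// addn1.
Qed.

Lemma right_stencil_le0 {R : realType} {alpha : R} {n i} {v : nat -> R} :
  1 < alpha < 2 -> (i <= n)%N -> 0 <= v i ->
  (forall i', (i' <= n.+1)%N -> v i' <= v i) ->
  \sum_(0 <= l < (n - i + 3)%N) g alpha l * v (i + l - 1)%N <= 0.
Proof.
(* The last index is [l = n - i + 2], which reaches the boundary node [n.+1] and no further. *)
move=> a12 iN v0 vmax; rewrite addnS.
apply: (sum_gM_le0 (v := fun l => v (i + l - 1)%N));
  rewrite ?addnK ?addn2// => l lN.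
by rewrite vmax// leq_subLR; move: iN lN; clear; lia.
Qed.

(** * Sign of the Riesz coefficient and closure of an open interval *)

Lemma riesz_coef_gt0 (R : realType) (alpha : R) :
  1 < alpha < 2 -> 0 < riesz_coef alpha.
Proof.
move=> /andP[a1 a2]; rewrite /riesz_coef oppr_gt0 invr_lt0 pmulr_rlt0//.
have pi0 := pi_gt0 R.
(* The angle lies between [pi / 2] and [pi]; subtracting [pi] brings it into the range where the
   cosine is positive and flips the sign. *)
have -> : alpha * pi / 2 = (alpha * pi / 2 - pi) + pi by rewrite subrK.
rewrite cosDpi oppr_lt0; apply: cos_gt0_pihalf.
by apply/andP; split; nra.
Qed.

Lemma closure_oo (R : realType) (a b x : R) : a < b -> a <= x <= b ->
  closure (`]a, b[ : set R^o) x.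
Proof.
move=> ab /andP[ax xb] B Bx.
(* Points of the interval approach [x] from the right, or from the left when [x] is the right
   endpoint. *)
have [xltb|blex] := ltP x b.
  have Br : \forall z \near x^'+, B z by exact: cvg_within Bx.
  have : \forall z \near x^'+, (`]a, b[ `&` B) z.
    near=> z; split; last by near: z.
    rewrite /= in_itv/=; apply/andP; split; last by near: z; exact: nbhs_right_lt.
    by apply: le_lt_trans ax _; near: z; exact: nbhs_right_gt.
  exact: filter_ex.
have Bl : \forall z \near x^'-, B z by exact: cvg_within Bx.
have : \forall z \near x^'-, (`]a, b[ `&` B) z.
  near=> z; split; last by near: z.
  rewrite /= in_itv/=; apply/andP; split.
    by near: z; apply: nbhs_left_gt; exact: lt_le_trans blex.
  by apply: lt_le_trans xb; near: z; exact: nbhs_left_lt.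
exact: filter_ex.
Unshelve. all: by end_near.
Qed.

(** * The implicit operator and its maximum principle *)

Section Scheme.
Context {R : realType} (P : problem R) (n1 n2 m : nat).
Hypotheses (hxx : xmin P < xmax P) (hyy : ymin P < ymax P) (ht : 0 < tmax P).
Hypotheses (ha1 : 1 < alpha1 P < 2) (ha2 : 1 < alpha2 P < 2).
Hypotheses (hkx : 0 < kx P) (hky : 0 < ky P) (heta : 0 < eta_pen P).

Lemma hx_gt0 : 0 < hx P n1.
Proof. by rewrite divr_gt0 ?subr_gt0. Qed.

Lemma hy_gt0 : 0 < hy P n2.
Proof. by rewrite divr_gt0 ?subr_gt0. Qed.

Lemma dt_ge0 : 0 <= dt P m.
Proof. by rewrite divr_ge0 ?(ltW ht). Qed.

Lemma cx_ge0 : 0 <= cx P n1 m.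
Proof.
have rc := ltW (riesz_coef_gt0 R (alpha1 P) ha1).
by rewrite divr_ge0 ?powR_ge0// !mulr_ge0 ?dt_ge0// ltW.
Qed.

Lemma cy_ge0 : 0 <= cy P n2 m.
Proof.
have rc := ltW (riesz_coef_gt0 R (alpha2 P) ha2).
by rewrite divr_ge0 ?powR_ge0// !mulr_ge0 ?dt_ge0// ltW.
Qed.

Lemma pen_ge0 i j : 0 <= pen P n1 n2 m i j.
Proof. by rewrite /pen; case: ifP => // _; rewrite divr_ge0 ?dt_ge0 ?(ltW heta). Qed.

Lemma scheme_lhsB u v i j k :
  scheme_lhs P n1 n2 m (fun i j k => u i j k - v i j k) i j k =
  scheme_lhs P n1 n2 m u i j k - scheme_lhs P n1 n2 m v i j k.
Proof.
have sumB n a (F G : nat -> R) : \sum_(0 <= l < n) g a l * (F l - G l) =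
    \sum_(0 <= l < n) g a l * F l - \sum_(0 <= l < n) g a l * G l.
  by rewrite -sumrB; apply: eq_bigr => l _; rewrite mulrBr.
rewrite /scheme_lhs !sumB; ring.
Qed.

(** At such a node the four stencil sums are nonpositive and enter with factors [- cx] and [- cy],
    while the penalty term is nonnegative: every term added to [w i j k] has the right sign. *)
Lemma scheme_lhs_ge_at_max w i j k : (1 <= i <= n1)%N -> (1 <= j <= n2)%N ->
  0 <= w i j k ->
  (forall i' j', (i' <= n1.+1)%N -> (j' <= n2.+1)%N -> w i' j' k <= w i j k) ->
  w i j k <= scheme_lhs P n1 n2 m w i j k.
Proof.
move=> /andP[_ iN] /andP[_ jN] w0 wmax; rewrite /scheme_lhs.
have wx i' : (i' <= n1.+1)%N -> w i' j k <= w i j k.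
  by move=> iN'; apply: wmax => //; exact: leqW.
have wy j' : (j' <= n2.+1)%N -> w i j' k <= w i j k.
  by move=> jN'; apply: wmax => //; exact: leqW.
have L1 := left_stencil_le0 (v := fun i => w i j k) ha1 iN w0 wx.
have R1 := right_stencil_le0 (v := fun i => w i j k) ha1 iN w0 wx.
have L2 := left_stencil_le0 (v := fun j => w i j k) ha2 jN w0 wy.
have R2 := right_stencil_le0 (v := fun j => w i j k) ha2 jN w0 wy.
have := mulr_ge0_le0 cx_ge0 L1; have := mulr_ge0_le0 cx_ge0 R1.
have := mulr_ge0_le0 cy_ge0 L2; have := mulr_ge0_le0 cy_ge0 R2.
have := mulr_ge0 (pen_ge0 i j) w0.
by lra.
Qed.

Lemma scheme_max_principle w k B : 0 <= B ->
  (forall j, (1 <= j <= n2)%N -> w 0%N j k <= 0 /\ w n1.+1 j k <= 0) ->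
  (forall i, (i <= n1.+1)%N -> w i 0%N k <= 0 /\ w i n2.+1 k <= 0) ->
  (forall i j, (1 <= i <= n1)%N -> (1 <= j <= n2)%N ->
     scheme_lhs P n1 n2 m w i j k <= B) ->
  forall i j, (1 <= i <= n1)%N -> (1 <= j <= n2)%N -> w i j k <= B.
Proof.
move=> B0 w0x w0y wB i j iN jN.
(* The maximum is taken over the whole grid, sides included, since the stencils reach the boundary
   nodes. *)
pose F (p : 'I_n1.+2 * 'I_n2.+2) := w p.1 p.2 k.
have [[p q] _ pmax] := @arg_maxP _ _ _ (ord0, ord0) xpredT F isT.
have {}pmax i' j' : (i' <= n1.+1)%N -> (j' <= n2.+1)%N -> w i' j' k <= w p q k.
  move=> hi hj; have := pmax (inord i', inord j') isT.
  by rewrite /F /= !inordK.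
have ijp : w i j k <= w p q k.
  by case/andP: iN jN => _ iN /andP[_ jN]; apply: pmax; exact: leqW.
apply: (le_trans ijp); have [wp|/ltW wp] := leP (w p q k) 0.
  exact: le_trans wp B0.
have pqB : (1 <= p <= n1)%N -> (1 <= q <= n2)%N -> w p q k <= B.
  by move=> hp hq; apply: le_trans (wB _ _ hp hq); exact: scheme_lhs_ge_at_max.
have pN : (p <= n1.+1)%N := ltn_ord p; have qN : (q <= n2.+1)%N := ltn_ord q.
(* The horizontal sides come first: [w0y] covers the corners, whereas [w0x] requires an interior
   [q]. *)
have [q0|q0] := eqVneq (q : nat) 0%N.
  by rewrite q0; apply: le_trans B0; apply w0y.
have [qn|qn] := eqVneq (q : nat) n2.+1.
  by rewrite qn; apply: le_trans B0; apply w0y.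
have hq : (1 <= q <= n2)%N by rewrite lt0n q0 -ltnS ltn_neqAle qn.
have [p0|p0] := eqVneq (p : nat) 0%N.
  by rewrite p0; apply: le_trans B0; apply w0x.
have [pn|pn] := eqVneq (p : nat) n1.+1.
  by rewrite pn; apply: le_trans B0; apply w0x.
by apply: pqB; rewrite // lt0n p0 -ltnS ltn_neqAle pn.
Qed.

Lemma scheme_max_principle_norm w k B : 0 <= B ->
  (forall j, (1 <= j <= n2)%N -> w 0%N j k = 0 /\ w n1.+1 j k = 0) ->
  (forall i, (i <= n1.+1)%N -> w i 0%N k = 0 /\ w i n2.+1 k = 0) ->
  (forall i j, (1 <= i <= n1)%N -> (1 <= j <= n2)%N ->
     `|scheme_lhs P n1 n2 m w i j k| <= B) ->
  forall i j, (1 <= i <= n1)%N -> (1 <= j <= n2)%N -> `|w i j k| <= B.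
Proof.
move=> B0 w0x w0y wB i j iN jN; rewrite ler_norml lerNl; apply/andP; split.
  rewrite -sub0r.
  (* The lower bound is the upper bound for the opposite function, written [0 - w] so that
     [scheme_lhsB] gives its image under the operator. *)
  apply: (@scheme_max_principle (fun i j k => 0 - w i j k)) => //.
  - by move=> j' /w0x[-> ->]; rewrite subr0.
  - by move=> i' /w0y[-> ->]; rewrite subr0.
  move=> i' j' hi hj; rewrite (scheme_lhsB (fun _ _ _ => 0)).
  have -> : scheme_lhs P n1 n2 m (fun _ _ _ => 0) i' j' k = 0.
    rewrite (_ : (fun _ _ _ => 0) = fun i j k => w i j k - w i j k).
      by rewrite scheme_lhsB subrr.
    by do 3 (apply/funext => ?); rewrite subrr.
  by rewrite sub0r lerNl; have /ler_normlP[] := wB _ _ hi hj; rewrite lerNl.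
apply: (@scheme_max_principle w) => //.
- by move=> j' /w0x[-> ->].
- by move=> i' /w0y[-> ->].
by move=> i' j' hi hj; apply: le_trans (ler_norm _) _; exact: wB.
Qed.

(** * Position of the nodes, and the Lipschitz bound on the right-hand side *)

Lemma xg_in i : (1 <= i <= n1)%N -> xmin P < xg P n1 i < xmax P.
Proof.
move=> /andP[i1 iN]; rewrite /xg ltrDl mulr_gt0 ?hx_gt0 ?ltr0n//=.
rewrite -ltrBrDl /hx mulrA ltr_pdivrMr ?ltr0n// mulrC.
by rewrite ltr_pM2l ?subr_gt0// ltr_nat.
Qed.

Lemma yg_in j : (1 <= j <= n2)%N -> ymin P < yg P n2 j < ymax P.
Proof.
move=> /andP[i1 iN]; rewrite /yg ltrDl mulr_gt0 ?hy_gt0 ?ltr0n//=.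
rewrite -ltrBrDl /hy mulrA ltr_pdivrMr ?ltr0n// mulrC.
by rewrite ltr_pM2l ?subr_gt0// ltr_nat.
Qed.

Lemma xg0 : xg P n1 0 = xmin P.
Proof. by rewrite /xg mul0r addr0. Qed.

Lemma xgN : xg P n1 n1.+1 = xmax P.
Proof. by rewrite /xg /hx mulrC divfK ?pnatr_eq0// addrC subrK. Qed.

Lemma yg0 : yg P n2 0 = ymin P.
Proof. by rewrite /yg mul0r addr0. Qed.

Lemma ygN : yg P n2 n2.+1 = ymax P.
Proof. by rewrite /yg /hy mulrC divfK ?pnatr_eq0// addrC subrK. Qed.

Lemma xg_bounds i : (i <= n1.+1)%N -> xmin P <= xg P n1 i <= xmax P.
Proof.
move=> iN; rewrite -xgN /xg lerDl lerD2l ler_wpM2r ?ler_nat ?(ltW hx_gt0)//.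
by rewrite mulr_ge0 ?(ltW hx_gt0).
Qed.

Lemma yg_bounds j : (j <= n2.+1)%N -> ymin P <= yg P n2 j <= ymax P.
Proof.
move=> jN; rewrite -ygN /yg lerDl lerD2l ler_wpM2r ?ler_nat ?(ltW hy_gt0)//.
by rewrite mulr_ge0 ?(ltW hy_gt0).
Qed.

Lemma tg_in k : (0 < m)%N -> (k <= m)%N -> 0 <= tg P m k <= tmax P.
Proof.
move=> m0 km; rewrite /tg mulr_ge0 ?dt_ge0//= /dt mulrA ler_pdivrMr ?ltr0n//.
by rewrite mulrC ler_pM2l// ler_nat.
Qed.

Lemma tg_gt0 k : (0 < m)%N -> (0 < k)%N -> 0 < tg P m k.
Proof. by move=> m0 k0; rewrite mulr_gt0 ?divr_gt0 ?ltr0n. Qed.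

(** Each coordinate is approximated separately through [closure_oo]. This is what allows the
    boundary condition of the penalized problem to be used at the outer grid nodes. *)
Lemma boundary_rect (x y : R) : xmin P <= x <= xmax P -> ymin P <= y <= ymax P ->
  ~ rect P (x, y) -> boundary (rect P) (x, y).
Proof.
move=> hx hy nxy; split; last by move=> /interior_subset.
move=> B [[U V] [/= Ux Vy] UVB].
have [x' [xr Ux']] := closure_oo _ _ _ _ hxx hx U Ux.
have [y' [yr Vy']] := closure_oo _ _ _ _ hyy hy V Vy.
by exists (x', y'); split => //; apply: UVB.
Qed.

(** The source is explicit, evaluated at level [k.-1], so its Lipschitz bound contributes only the
    increment [c2 * dt P m] to the growth factor. *)
Lemma scheme_rhs_dist c2 u v i j k : (0 < m)%N ->
  (forall x y t : R, rect P (x, y) -> 0 <= t <= tmax P ->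
     c2.-lipschitz (fun v => fhat P v x y t)) ->
  (1 <= i <= n1)%N -> (1 <= j <= n2)%N -> (1 <= k <= m)%N ->
  `|scheme_rhs P n1 n2 m u i j k - scheme_rhs P n1 n2 m v i j k|
    <= (1 + c2 * dt P m) * `|u i j k.-1 - v i j k.-1|.
Proof.
move=> m0 hlip iN jN /andP[k1 km]; rewrite /scheme_rhs.
have rij : rect P (xg P n1 i, yg P n2 j).
  by split; rewrite /= in_itv/=; [exact: xg_in|exact: yg_in].
have tk : 0 <= tg P m k.-1 <= tmax P.
  by apply: tg_in => //; apply: leq_trans (leq_pred _) km.
have /= fl := hlip _ _ _ rij tk (u i j k.-1, v i j k.-1) (conj I I).
rewrite opprD addrACA -mulrBr.
apply: le_trans (ler_normD _ _) _.
rewrite mulrDl mul1r lerD2l normrM ger0_norm ?dt_ge0// -mulrA mulrCA.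
by rewrite ler_wpM2l ?dt_ge0.
Qed.

End Scheme.

(** * Error recursion and discrete Gronwall bound *)

Theorem lemma3p3 (R : realType) (P : problem R) (c2 : R)
    (ueta : R -> R -> R -> R) :
  xmin P < xmax P -> ymin P < ymax P -> 0 < tmax P ->
  1 < alpha1 P < 2 -> 1 < alpha2 P < 2 ->
  0 < kx P -> 0 < ky P -> 0 < eta_pen P ->
  convex_set (Omega P) -> Omega P `<=` rect P ->
  (forall x y : R, Omega P (x, y) -> u0hat P x y = u0 P x y) ->
  (forall v x y : R, Omega P (x, y) ->
     [lipschitz f P v x y t | t in `[0, tmax P]]) ->
  0 < c2 ->
  (forall x y t : R, rect P (x, y) -> 0 <= t <= tmax P ->
     c2.-lipschitz (fun v => fhat P v x y t)) ->
  unique_pp_solution P ueta ->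
  consistent P ueta ->
  exists2 c : R, 0 < c &
    forall n1 n2 m : nat, (0 < n1)%N -> (0 < n2)%N -> (0 < m)%N ->
    forall u : nat -> nat -> nat -> R, scheme_solution P n1 n2 m u ->
    forall k : nat, (1 <= k <= m)%N ->
      max_norm n1 n2 (fun i j => on_grid P n1 n2 m ueta i j k - u i j k)
        <= c * (dt P m + hx P n1 + hy P n2).

Proof.
move=> hxx hyy ht ha1 ha2 hkx hky heta _ _ _ _ hc2 hlip [[_ _ u_init u_bd] _].
case=> c0 hc0.
(* The factor [expR (c2 * tmax P) / c2] comes from the Gronwall sum; [|c0| + 1] replaces [c0] to
   make positivity immediate. *)
exists (expR (c2 * tmax P) * (`|c0| + 1) / c2).
  by rewrite !mulr_gt0 ?expR_gt0 ?invr_gt0// ltr_wpDl.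
move=> n1 n2 m n1p n2p mp u [u_eq u0 u_x u_y] k0 /andP[k0p k0m].
have [r hr] := hc0 n1 n2 m n1p n2p mp.
set s := dt P m + hx P n1 + hy P n2.
have s0 : 0 <= s by rewrite !addr_ge0 ?dt_ge0// ltW ?hx_gt0 ?hy_gt0.
pose C := (`|c0| + 1) * s.
have C0 : 0 <= C by rewrite mulr_ge0// addr_ge0.
have dt0 : 0 <= dt P m by exact: dt_ge0.
have q1 : 1 <= 1 + c2 * dt P m by rewrite lerDl mulr_ge0// ltW.
(* [E] is the solution of the recursion [ES] with [E 0 = 0]. *)
pose E k := ((1 + c2 * dt P m) ^+ k - 1) / c2 * C.
have E0 k : 0 <= E k by rewrite !mulr_ge0 ?invr_ge0 ?(ltW hc2)// subr_ge0 exprn_ege1.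
have ES k : E k.+1 = (1 + c2 * dt P m) * E k + dt P m * C.
  by rewrite /E exprS; field; rewrite gt_eqF.
pose w := on_grid P n1 n2 m ueta.
(* Level 0 is excluded because the boundary condition holds only for positive times. *)
have w_bd i j k : (i <= n1.+1)%N -> (j <= n2.+1)%N -> (1 <= k <= m)%N ->
    ~ rect P (xg P n1 i, yg P n2 j) -> w i j k = 0.
  move=> iN jN /andP[k1 km] nrect; apply: u_bd.
    by apply: boundary_rect => //; [exact: xg_bounds|exact: yg_bounds].
  by rewrite tg_gt0//; have /andP[] := @tg_in _ P m ht k mp km.
have err k : (k <= m)%N -> forall i j, (1 <= i <= n1)%N -> (1 <= j <= n2)%N ->
    `|w i j k - u i j k| <= E k.
  (* At level 0 both functions equal [u0hat] at interior nodes, so the error starts from zero. *)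
  elim: k => [_ i j iN jN|k IH km].
    have [/andP[_ iN'] /andP[_ jN']] := (iN, jN).
    rewrite u0 ?leqW// /w /on_grid /tg mul0r u_init ?subrr ?normr0//.
    by split; rewrite /= in_itv/=; [exact: xg_in|exact: yg_in].
  have k1m : (1 <= k.+1 <= m)%N by [].
  apply: (scheme_max_principle_norm P n1 n2 m ht ha1 ha2 hkx hky heta
           (fun i j k => w i j k - u i j k)) => //.
  - move=> j /andP[_ /leqW jN].
    have [-> ->] := u_x j k.+1 jN k1m.
    rewrite !w_bd ?subrr ?leqnSn//.
    + by case=> /=; rewrite xgN in_itv/= ltxx andbF.
    + by case=> /=; rewrite xg0 in_itv/= ltxx.
  - move=> i iN.
    have [-> ->] := u_y i k.+1 iN k1m.
    rewrite !w_bd ?subrr ?leqnSn//.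
    + by case=> /= _; rewrite ygN in_itv/= ltxx andbF.
    + by case=> /= _; rewrite yg0 in_itv/= ltxx.
  move=> i j iN jN.
  have [w_eq r_le] := hr i j k.+1 iN jN k1m.
  (* By linearity the operator applied to the error is the difference of the right-hand sides plus
     the truncation term; these two pieces match the two terms of [ES]. *)
  rewrite scheme_lhsB w_eq u_eq// addrAC ES.
  apply: le_trans (ler_normD _ _) (lerD _ _).
    apply: le_trans (scheme_rhs_dist P n1 n2 m hxx hyy ht c2 _ _ i j k.+1
                       mp hlip iN jN k1m) _.
    by rewrite ler_wpM2l ?(le_trans ler01)//=; apply: IH => //; exact: ltnW.
  rewrite normrM ger0_norm// ler_wpM2l// (le_trans (ltW r_le))//.
  have -> : hx P n1 + hy P n2 + dt P m = s by rewrite /s; ring.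
  by rewrite ler_wpM2r// (le_trans (ler_norm _))// lerDl.
have Ek : E k0 <= expR (c2 * tmax P) * (`|c0| + 1) / c2 * s.
  rewrite /E /C [leRHS](_ : _ = expR (c2 * tmax P) / c2 * ((`|c0| + 1) * s));
    last by ring.
  rewrite ler_wpM2r// ler_wpM2r ?invr_ge0 ?(ltW hc2)//.
  (* The [- 1] is dropped and [1 + x <= expR x] is raised to the power [k0]; the exponent is then
     [c2] times the time level [tg P m k0], at most [tmax P]. *)
  apply: (@le_trans _ _ (expR (c2 * dt P m) ^+ k0)).
    rewrite lerBlDr (le_trans (lerXn2r _ _ _ (expR_ge1Dx _))) ?nnegrE ?expR_ge0 ?lerDl//.
    exact: le_trans q1.
  rewrite -expRM_natl ler_expR mulrCA ler_wpM2l ?(ltW hc2)//.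
  by have /andP[] := @tg_in _ P m ht k0 mp k0m.
apply: le_trans Ek.
(* The default value 0 of the maximum is also below [E k0], by [E0]. *)
rewrite /max_norm big_nat; apply: bigmax_le => // i iN.
rewrite big_nat; apply: bigmax_le => // j jN.
exact: err.
Qed.
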